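(* Let $(X,r)$ be a strong semilattice $Y$ of solutions $(X_\alpha,r_\alpha)$ indexed by a finite semilattice $Y$. Then $r_\alpha$ is a solution with finite order on $X_\alpha$ for every $\alpha\in Y$ if and only if $r$ is a solution with finite order. More precisely, the index of $r$ is $$\mathrm{i}(r)=\max\big(\{1\}\cup\{\mathrm{i}(r_\alpha)\mid\alpha\in Y\}\big)$$ and the period of $r$ is $$\mathrm{p}(r)=\operatorname{lcm}\{\mathrm{p}(r_\alpha)\mid\alpha\in Y\}.$$
   Context: A set-theoretic solution of the Yang-Baxter equation (briefly, a solution) on a set $X$ is a map $r:X\times X\to X\times X$ (not necessarily bijective) such that, on $X^3$, $(r\times\mathrm{id}_X)(\mathrm{id}_X\times r)(r\times\mathrm{id}_X)=(\mathrm{id}_X\times r)(r\times\mathrm{id}_X)(\mathrm{id}_X\times r)$. A (lower) semilattice $Y$ is a commutative semigroup, written multiplicatively, in which every element is idempotent, ordered by $\alpha\geq\beta$ if and only if $\alpha\beta=\beta$. Strong semilattice of solutions: let $Y$ be a (lower) semilattice, $\{X_\alpha\mid\alpha\in Y\}$ a family of disjoint sets, $r_\alpha$ a solution on $X_\alpha$ for every $\alpha\in Y$, and for each pair $\alpha\geq\beta$ in $Y$ let $\phi_{\alpha,\beta}:X_\alpha\to X_\beta$ be a map, such that: (1) $\phi_{\alpha,\alpha}$ is the identity map of $X_\alpha$ for every $\alpha\in Y$; (2) $\phi_{\beta,\gamma}\phi_{\alpha,\beta}=\phi_{\alpha,\gamma}$ whenever $\alpha\geq\beta\geq\gamma$;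 (3) $(\phi_{\alpha,\beta}\times\phi_{\alpha,\beta})r_\alpha=r_\beta(\phi_{\alpha,\beta}\times\phi_{\alpha,\beta})$ whenever $\alpha\geq\beta$. Set $X=\bigcup\{X_\alpha\mid\alpha\in Y\}$ and define $r:X\times X\to X\times X$ by $r(x,y):=r_{\alpha\beta}(\phi_{\alpha,\alpha\beta}(x),\phi_{\beta,\alpha\beta}(y))$ for $x\in X_\alpha$, $y\in X_\beta$. Then $r$ is a solution on $X$, and $(X,r)$ is called the strong semilattice $Y$ of solutions $(X_\alpha,r_\alpha)$. A solution $r$ is of finite order if there exist a non-negative integer $i$ and a positive integer $p$ such that $r^{p+i}=r^i$ (with $r^0=\mathrm{id}$). In that case its index and period are $$\mathrm{i}(r):=\min\{j\mid j\in\mathbb{N}_0,\ \exists\, l\in\mathbb{N}:\ r^j=r^l,\ j\neq l\},\qquad \mathrm{p}(r):=\min\{k\mid k\in\mathbb{N},\ r^{\mathrm{i}(r)+k}=r^{\mathrm{i}(r)}\},$$ where $\mathbb{N}$ denotes the positive integers and $\mathbb{N}_0=\mathbb{N}\cup\{0\}$. The formulas for $\mathrm{i}(r)$ and $\mathrm{p}(r)$ are asserted when the solutions are of finite order.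
   Formalization: The index formula is stated only when two distinct X_α are nonempty or some r_α is not bijective; otherwise it fails, since r is then bijective of finite order and i(r)=0, not 1 (e.g. Y a single point and r_α the identity). *)

(* Defs.v *)
From HB Require Import structures.
From mathcomp Require Import all_boot all_order.
From mathcomp Require Import boolp classical_sets.

Set Implicit Arguments.
Unset Strict Implicit.
Unset Printing Implicit Defensive.

Import Order.Theory.
Local Open Scope order_scope.

(* The cube of X is the left-nested product X * X * X = (X * X) * X. *)
Definition on12 (X : Type) (r : X * X -> X * X) (t : X * X * X) : X * X * X :=
  (r t.1, t.2).

Definition on23 (X : Type) (r : X * X -> X * X) (t : X * X * X) : X * X * X :=
  let z := r (t.1.2, t.2) in (t.1.1, z.1, z.2).

Definition yb_solution (X : Type) (r : X * X -> X * X) : Prop :=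
  on12 r \o on23 r \o on12 r =1 on23 r \o on12 r \o on23 r.

(* [iter n r] is the n-th compositional power; [=1] is pointwise equality. *)
Definition finite_order (T : Type) (r : T -> T) : Prop :=
  exists i p : nat, (0 < p)%N /\ iter (p + i) r =1 iter i r.

(* The least element of P (0 if P is empty). *)
Definition nat_min (P : set nat) : nat :=
  xget 0%N (fun n => P n /\ forall m, P m -> (n <= m)%N).

(* Meaningful only for maps of finite order, like [map_period]. *)
Definition map_index (T : Type) (r : T -> T) : nat :=
  nat_min (fun j =>
    exists l : nat, [/\ (0 < l)%N, iter j r =1 iter l r & j <> l]).

Definition map_period (T : Type) (r : T -> T) : nat :=
  nat_min (fun k =>
    (0 < k)%N /\ iter (map_index r + k) r =1 iter (map_index r) r).

Section StrongSemilattice.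
(* A semilattice is a [meetSemilatticeType]: the product is [a `&` b], and
   [b <= a] is equivalent to [b `&` a = b] by [leEmeet]. *)
Variables (d : Order.disp_t) (Y : meetSemilatticeType d) (X : Y -> Type).

Record strong_semilattice (r : forall a, X a * X a -> X a * X a)
    (phi : forall a b : Y, b <= a -> X a -> X b) : Prop := StrongSemilattice {
  ss_solution : forall a, yb_solution (r a);
  ss_id : forall a (le_aa : a <= a), phi a a le_aa =1 id;
  ss_comp : forall a b c (le_ba : b <= a) (le_cb : c <= b) (le_ca : c <= a),
    phi b c le_cb \o phi a b le_ba =1 phi a c le_ca;
  ss_morph : forall a b (le_ba : b <= a) (x y : X a),
    let f := phi a b le_ba in
    (f (r a (x, y)).1, f (r a (x, y)).2) = r b (f x, f y)
}.

(* The union of the disjoint family X. *)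
Definition ss_carrier : Type := {a : Y & X a}.

Definition ss_map (r : forall a, X a * X a -> X a * X a)
    (phi : forall a b : Y, b <= a -> X a -> X b)
    (p : ss_carrier * ss_carrier) : ss_carrier * ss_carrier :=
  let: (existT a x, existT b y) := p in
  let z := r (a `&` b) (phi a (a `&` b) (leIl a b) x,
                        phi b (a `&` b) (leIr b a) y) in
  (existT X (a `&` b) z.1, existT X (a `&` b) z.2).

End StrongSemilattice.

(* Main.v *)
Require Import Defs.
From HB Require Import structures.
From mathcomp Require Import all_boot all_order.
From mathcomp Require Import boolp classical_sets.
From Stdlib Require Import Eqdep_dec.

(** Pairs with both entries in one component [X a] are stable under [r], which
    acts on them as [r_a]; and after a single step every pair [(x, y)] of
    [X a * X b] lies in [X (ab) * X (ab)].  Hence, for [n >= 1],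
    [r^n (x, y) = r_(ab)^n (phi x, phi y)], so that for positive exponents
    [r^j = r^l] if and only if [r_a^j = r_a^l] for every [a]
    ([iter_ss_map_eq]).

    The rest is arithmetic of a single map [f] of finite order: for
    [j >= i(f)] one has [f^(j + k) = f^j] exactly when [p(f)] divides [k]
    ([map_period_dvdP]), while [i(f) <= j] exactly when [f^(j + k) = f^j] for
    some [k > 0] ([map_index_leP]).  Reading these at a positive exponent [j]
    turns the equivalence above into [i(r) <= j <-> (forall a, i(r_a) <= j)]
    and [p(r) %| k <-> (forall a, p(r_a) %| k)], that is, into the maximum
    and the least common multiple.  The maximum includes 1 because only
    positive [j] are covered.  Index 0 is excluded separately: it would mean
    [r^l = id] for some [l > 0], which makes every [r_a] bijective, and which
    leaves at most one component nonempty since [r^l] sends [X a * X b] into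
    [X (ab) * X (ab)].

    For the Yang-Baxter equation, compatibility of the [phi]'s with the
    [r_a]'s shows that both sides, applied to [(x, y, z)] in
    [X a * X b * X c], are the corresponding sides for [r_(abc)], applied to
    the images of [x], [y], [z] in [X (abc)]. *)

Set Implicit Arguments.
Unset Strict Implicit.
Unset Printing Implicit Defensive.

Import Order.Theory.

(** * Index and period of a map of finite order *)

Lemma nat_minP (P : set nat) (n0 : nat) :
  P n0 -> P (nat_min P) /\ forall m, P m -> nat_min P <= m.
Proof.
move=> Pn0; rewrite /nat_min.
have exP : exists n, `[< P n >] by exists n0; apply/asboolP.
apply: (@xgetI _ 0 (fun n => P n /\ forall m, P m -> n <= m) (ex_minn exP)).
case: ex_minnP => n /asboolP Pn le_n; split=> // m Pm.
by apply: le_n; apply/asboolP.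
Qed.

Section SingleMap.

Variables (T : Type) (f : T -> T).

Lemma iter_eq_le (i j k : nat) : i <= j ->
  iter (i + k) f =1 iter i f -> iter (j + k) f =1 iter j f.
Proof.
move=> /subnK <- eq_ik x.
by rewrite -addnA [LHS]iterD [RHS]iterD eq_ik.
Qed.

Lemma iter_eq_muln (i p n : nat) :
  iter (i + p) f =1 iter i f -> iter (i + n * p) f =1 iter i f.
Proof.
move=> eq_ip; elim: n => [|n IHn] x; first by rewrite mul0n addn0.
rewrite mulSn addnCA addnC.
by rewrite (iter_eq_le (leq_addr _ _) eq_ip) IHn.
Qed.

(** The set defining the index also admits an exponent [l] smaller than [j],
    but then [l] itself belongs to the set; so the minimum is the same as
    with [l = j + k], [k > 0]. *)
Lemma map_index_leP (j : nat) : finite_order f ->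
  (map_index f <= j <-> exists2 k, 0 < k & iter (j + k) f =1 iter j f).
Proof.
move=> [i [p [p_gt0 eq_pi]]].
pose P n := exists l : nat, [/\ 0 < l, iter n f =1 iter l f & n <> l].
have index_in j' k : 0 < k -> iter (j' + k) f =1 iter j' f -> P j'.
  move=> k_gt0 eq_jk; exists (j' + k); split=> [||/esym/eqP].
  - by rewrite ltn_addl.
  - by move=> x; rewrite eq_jk.
  - by rewrite -{2}[j']addn0 eqn_add2l; case: k k_gt0 {eq_jk}.
have eq_ip : iter (i + p) f =1 iter i f by move=> x; rewrite addnC eq_pi.
have [[l [l_gt0 eq_il ne_il]] le_i] := @nat_minP P i (index_in i p p_gt0 eq_ip).
rewrite -/(map_index f) in eq_il ne_il le_i.
split=> [le_ij|[k k_gt0 eq_jk]]; last exact: le_i (index_in _ _ k_gt0 eq_jk).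
case: (ltngtP (map_index f) l) => [lt_il|lt_li|//].
- exists (l - map_index f); first by rewrite subn_gt0.
  apply: (iter_eq_le le_ij) => x.
  by rewrite subnKC ?(ltnW lt_il) // eq_il.
- have := le_i l; rewrite leqNgt lt_li; case/(_ _)/negP => //.
  exists (map_index f); split=> [||/esym //]; first exact: leq_ltn_trans lt_li.
  by move=> x; rewrite eq_il.
Qed.

(** Past the index, an equality [f^(j + k) = f^j] can be pulled back to the
    index by going around the cycle, and there Euclidean division by the
    minimal period applies. *)
Lemma map_period_dvdP (j k : nat) : finite_order f -> map_index f <= j ->
  (iter (j + k) f =1 iter j f <-> map_period f %| k).
Proof.
move=> fin_f le_ij.
have [k0 k0_gt0 eq_k0] := (map_index_leP (map_index f) fin_f).1 (leqnn _).
have [[p_gt0 eq_p] le_p] := @nat_minP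
  (fun n => 0 < n /\ iter (map_index f + n) f =1 iter (map_index f) f)
  k0 (conj k0_gt0 eq_k0).
rewrite -/(map_period f) in p_gt0 eq_p le_p.
split=> [eq_jk|/dvdnP[n ->]]; last exact: iter_eq_le le_ij (iter_eq_muln n eq_p).
have eq_ik : iter (map_index f + k) f =1 iter (map_index f) f.
  move=> x; rewrite -[RHS](iter_eq_muln j eq_p).
  (* As p > 0, the exponent i + j * p is at least j. *)
  have le_j : j <= map_index f + j * map_period f.
    exact: leq_trans (leq_pmulr _ p_gt0) (leq_addl _ _).
  rewrite -(iter_eq_le le_j eq_jk) addnAC.
  by rewrite (iter_eq_le (leq_addr _ _) (iter_eq_muln j eq_p)).
have eq_mod : iter (map_index f + k %% map_period f) f =1 iter (map_index f) f.
  move=> x; rewrite -[RHS]eq_ik [in RHS](divn_eq k (map_period f)) addnA addnAC.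
  by rewrite [RHS](iter_eq_le (leq_addr _ _) (iter_eq_muln _ eq_p)).
rewrite /dvdn; case: (posnP (k %% map_period f)) => // mod_gt0.
by have := le_p _ (conj mod_gt0 eq_mod); rewrite leqNgt ltn_mod p_gt0.
Qed.

Lemma iter_id_bij (l : nat) : iter l.+1 f =1 id -> bijective f.
Proof.
move=> fl_id; exists (iter l f) => x; first by rewrite -iterSr fl_id.
by rewrite -iterS fl_id.
Qed.

End SingleMap.

(** * Powers of the map of a strong semilattice *)

Section Semilattice.

Variables (d : Order.disp_t) (Y : meetSemilatticeType d) (X : Y -> Type).
Variables (r : forall a, X a * X a -> X a * X a).
Variables (phi : forall a b : Y, (b <= a)%O -> X a -> X b).
Hypothesis hS : strong_semilattice r phi.

Definition ss_pair (a : Y) (p : X a * X a) : ss_carrier X * ss_carrier X :=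
  (existT X a p.1, existT X a p.2).

Lemma ss_pair_inj (a : Y) : injective (@ss_pair a).
Proof.
have inj_a := inj_pair2_eq_dec _ (@eq_comparable Y) X a.
by move=> [x y] [x' y'] [/inj_a -> /inj_a ->].
Qed.

(** The component [c] of the result is only required to equal [a `&` b], and
    the two inequalities are arbitrary; this absorbs the transports between
    the provably equal components [(ab)c] and [a(bc)], or [aa] and [a]. *)
Lemma ss_mapE (a b c : Y) (ca : (c <= a)%O) (cb : (c <= b)%O) x y :
  (a `&` b)%O = c ->
  ss_map r phi (existT X a x, existT X b y) =
    ss_pair (r (phi ca x, phi cb y)).
Proof.
move=> eq_c; subst c.
by rewrite /ss_map (bool_irrelevance (leIl a b) ca)
  (bool_irrelevance (leIr b a) cb).
Qed.

Lemma ss_map_pair (a : Y) p : ss_map r phi (ss_pair p) = ss_pair (r (a := a) p).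
Proof.
case: p => x y; rewrite [LHS](ss_mapE (lexx a) (lexx a)) ?meetxx //.
by rewrite !(ss_id hS).
Qed.

Lemma iter_ss_map_pair (n : nat) (a : Y) p :
  iter n (ss_map r phi) (ss_pair p) = ss_pair (iter n (r (a := a)) p).
Proof. by elim: n => //= n ->; rewrite ss_map_pair. Qed.

Lemma iter_ss_mapS (n : nat) (a b : Y) x y :
  iter n.+1 (ss_map r phi) (existT X a x, existT X b y) =
    ss_pair (iter n.+1 (r (a := (a `&` b)%O))
                  (phi (leIl a b) x, phi (leIr b a) y)).
Proof. by rewrite !iterSr (ss_mapE (leIl a b) (leIr b a)) // iter_ss_map_pair. Qed.

Lemma iter_ss_map_restr (j l : nat) (a : Y) :
  iter j (ss_map r phi) =1 iter l (ss_map r phi) ->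
  iter j (r (a := a)) =1 iter l (r (a := a)).
Proof. by move=> eq_jl p; apply: ss_pair_inj; rewrite -!iter_ss_map_pair. Qed.

(** Positivity is essential: after zero steps a pair with entries in two
    distinct components has not yet been moved into a single one. *)
Lemma iter_ss_map_eq (j l : nat) : 0 < j -> 0 < l ->
  (iter j (ss_map r phi) =1 iter l (ss_map r phi) <->
   forall a, iter j (r (a := a)) =1 iter l (r (a := a))).
Proof.
move=> j_gt0 l_gt0; split=> [eq_jl a|eq_jl]; first exact: iter_ss_map_restr.
case: j l j_gt0 l_gt0 eq_jl => // j [//|l] _ _ eq_jl [[a x] [b y]].
by rewrite !iter_ss_mapS eq_jl.
Qed.

(** Computing [r (x, y)] and then descending to [m] is the same as descending
    first; this is what lets both sides of the Yang-Baxter equation be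
    evaluated entirely in the lowest component. *)
Lemma ss_morph_comp (a b c m : Y) (ca : (c <= a)%O) (cb : (c <= b)%O)
    (mc : (m <= c)%O) (ma : (m <= a)%O) (mb : (m <= b)%O) x y :
  let z := r (phi ca x, phi cb y) in
  (phi mc z.1, phi mc z.2) = r (phi ma x, phi mb y).
Proof.
rewrite /= (ss_morph hS).
by rewrite -(ss_comp hS ca mc ma x) -(ss_comp hS cb mc mb y).
Qed.

Lemma ss_map_yb : yb_solution (ss_map r phi).
Proof.
(* The map is made abstract so that simplification does not unfold it. *)
move: (ss_map r phi) (@ss_mapE) => s sE.
move=> [[[a x] [b y]] [c z]].
have mab : ((a `&` b) `&` c <= a `&` b)%O := leIl _ _.
have mbc : ((a `&` b) `&` c <= b `&` c)%O by rewrite -meetA leIr.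
have ma : ((a `&` b) `&` c <= a)%O := le_trans mab (leIl _ _).
have mb : ((a `&` b) `&` c <= b)%O := le_trans mab (leIr _ _).
have mc : ((a `&` b) `&` c <= c)%O := leIr _ _.
move: (ss_solution hS (phi ma x, phi mb y, phi mc z)).
have := ss_morph_comp (leIl a b) (leIr b a) mab ma mb x y.
have := ss_morph_comp (leIl b c) (leIr c b) mbc mb mc y z.
have meet_ma : ((a `&` b) `&` c `&` (a `&` b) = (a `&` b) `&` c)%O.
  exact: meet_l.
set m := ((a `&` b) `&` c)%O in mab mbc ma mb mc meet_ma *.
rewrite /on12 /on23 /=.
rewrite (sE _ _ _ (leIl a b) (leIr b a)) // (sE _ _ _ (leIl b c) (leIr c b)) //=.
set u := r (_, _); set v := r (_, _) => eq_v eq_u.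
rewrite (sE _ _ _ mab mc) // (sE _ _ _ ma mbc) ?meetA //=.
rewrite -eq_u -eq_v /=.
rewrite (sE _ _ _ mab (lexx m)) 1?meetC // (sE _ _ _ (lexx m) mbc); last first.
  exact: meet_l.
rewrite !(ss_id hS) /ss_pair /=.
by case=> -> ->.
Qed.

End Semilattice.

(** * Order, index and period of a strong semilattice *)

Section FiniteSemilattice.

Variables (d : Order.disp_t) (Y : finMeetSemilatticeType d) (X : Y -> Type).
Variables (r : forall a, X a * X a -> X a * X a).
Variables (phi : forall a b : Y, (b <= a)%O -> X a -> X b).
Hypothesis hS : strong_semilattice r phi.

Let s := ss_map r phi.
Let i_max := maxn 1 (\max_(a : Y) map_index (r (a := a))).
Let p_lcm := \big[lcmn/1]_(a : Y) map_period (r (a := a)).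

Lemma i_max_leP (j : nat) :
  reflect (0 < j /\ forall a, map_index (r (a := a)) <= j) (i_max <= j).
Proof.
rewrite geq_max; apply: (iffP andP) => -[-> le_ij]; split=> //.
  by move=> a; apply: (bigmax_leqP _ _ _ le_ij).
by apply/bigmax_leqP.
Qed.

Lemma ss_iter_dvdP (j k : nat) : (forall a, finite_order (r (a := a))) ->
  i_max <= j -> (iter (j + k) s =1 iter j s <-> p_lcm %| k).
Proof.
move=> fin_r /i_max_leP[j_gt0 le_ij].
rewrite iter_ss_map_eq ?ltn_addr //; split=> [eq_jk|/dvdn_biglcmP dvd_k a].
  by apply/dvdn_biglcmP => a _; apply/(map_period_dvdP _ (fin_r a) (le_ij a)).
by apply/(map_period_dvdP _ (fin_r a) (le_ij a)); apply: dvd_k.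
Qed.

Lemma finite_order_component (a : Y) :
  finite_order s -> finite_order (r (a := a)).
Proof.
by move=> [i [p [p_gt0 eq_s]]]; exists i, p; split=> //; apply: iter_ss_map_restr eq_s.
Qed.

Lemma finite_order_ss :
  (forall a, finite_order (r (a := a))) -> finite_order s.
Proof.
move=> fin_r; exists i_max, p_lcm; split; last first.
  by move=> x; rewrite addnC; move: x; apply/ss_iter_dvdP.
rewrite /p_lcm; elim/big_rec: _ => // a p _ p_gt0.
rewrite lcmn_gt0 p_gt0 andbT.
have [k k_gt0 eq_k] := (map_index_leP _ (fin_r a)).1 (leqnn _).
exact: dvdn_gt0 k_gt0 ((map_period_dvdP k (fin_r a) (leqnn _)).1 eq_k).
Qed.

Lemma ss_period : finite_order s -> map_period s = p_lcm.
Proof.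
move=> fin_s; have fin_r a := finite_order_component a fin_s.
pose j := maxn (map_index s) i_max.
have dvdP k : map_period s %| k <-> p_lcm %| k.
  rewrite -(map_period_dvdP k fin_s (leq_maxl _ i_max)).
  exact: ss_iter_dvdP (leq_maxr _ _).
apply/eqP; rewrite eqn_dvd; apply/andP.
by split; [apply/dvdP | apply/dvdP].
Qed.

Lemma ss_index_le (j : nat) : finite_order s -> 0 < j ->
  (map_index s <= j <-> i_max <= j).
Proof.
move=> fin_s j_gt0; have fin_r a := finite_order_component a fin_s.
rewrite (map_index_leP _ fin_s); split=> [[k k_gt0 eq_jk]|le_ij].
  apply/i_max_leP; split=> // a; apply/(map_index_leP _ (fin_r a)).
  by exists k => //; apply: iter_ss_map_restr eq_jk.
have [i [p [p_gt0 eq_p]]] := fin_s.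
(* The exponent p of an eventual period serves as the required positive
   multiple of the least common multiple. *)
have dvd_p : p_lcm %| p.
  rewrite -ss_period //.
  have le_i : map_index s <= maxn (map_index s) i := leq_maxl _ _.
  apply/(map_period_dvdP _ fin_s le_i); apply: iter_eq_le (leq_maxr _ i) _.
  by move=> x; rewrite addnC eq_p.
by exists p => //; apply/ss_iter_dvdP.
Qed.

(** A power that is the identity makes each [r_a] bijective, and fixes a pair
    over [(a, b)] although it moves it over [(ab, ab)]. *)
Lemma ss_index_gt0 : finite_order s ->
  (exists a b : Y, [/\ a <> b, inhabited (X a) & inhabited (X b)]) \/
  (exists a : Y, ~ bijective (r (a := a))) ->
  0 < map_index s.
Proof.
move=> fin_s hyp; rewrite lt0n; apply/negP => /eqP index0.
have [|[//|k] _ eq_id] := (map_index_leP 0 fin_s).1; first by rewrite index0.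
case: hyp => [[a [b [ne_ab [x] [y]]]]|[a []]].
  have := eq_id (existT X a x, existT X b y).
  rewrite add0n iter_ss_mapS // /ss_pair => -[eq_a _ eq_b _].
  by apply: ne_ab; rewrite -eq_a eq_b.
by apply: (@iter_id_bij _ _ k); apply: iter_ss_map_restr (a) eq_id.
Qed.

Lemma ss_index : finite_order s -> 0 < map_index s -> map_index s = i_max.
Proof.
move=> fin_s index_gt0; apply/eqP; rewrite eqn_leq; apply/andP; split.
  by apply/ss_index_le => //; rewrite leq_maxl.
exact/ss_index_le.
Qed.

End FiniteSemilattice.

Theorem theorem15 (d : Order.disp_t) (Y : finMeetSemilatticeType d)
    (X : Y -> Type) (r : forall a : Y, X a * X a -> X a * X a)
    (phi : forall a b : Y, (b <= a)%O -> X a -> X b)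
    (hS : strong_semilattice r phi) :
  ((forall a : Y, yb_solution (r a) /\ finite_order (r a)) <->
   (yb_solution (ss_map r phi) /\ finite_order (ss_map r phi))) /\
  (finite_order (ss_map r phi) ->
   (((exists a b : Y, [/\ a <> b, inhabited (X a) & inhabited (X b)]) \/
     (exists a : Y, ~ bijective (r a))) ->
    map_index (ss_map r phi) = maxn 1 (\max_(a : Y) map_index (r a))) /\
   map_period (ss_map r phi) = \big[lcmn/1%N]_(a : Y) map_period (r a)).
Proof.
split; last first.
  move=> fin_s; split; last exact: ss_period.
  by move=> hyp; apply: ss_index => //; apply: ss_index_gt0.
split=> [sol_r|[_ fin_s] a].
  by split; [apply: ss_map_yb | apply: finite_order_ss => // a; case: (sol_r a)].
by split; [apply: ss_solution hS a | apply: finite_order_component fin_s].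
Qed.
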